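(* Let $P$ be a finite nonempty set of points in the plane $\mathbb{R}^2$ in general position (as defined in the context). Then the $\mathrm{Y}_3$-graph of $P$ is connected.
   Context: Cones: for a point $p\in\mathbb{R}^2$, the three rays from $p$ making angles that are consecutive multiples of $2\pi/3$ with the negative $y$-axis partition the plane into three cones with apex $p$. They are labelled $C_0^p, C_1^p, C_2^p$ in clockwise order around $p$, where $C_0^p$ is the cone whose angular bisector is the ray from $p$ in the direction of the positive $y$-axis. Thus, measuring angles counterclockwise from the positive $x$-axis, $C_0^p$ spans directions from $30^\circ$ to $150^\circ$, $C_1^p$ spans directions from $-90^\circ$ to $30^\circ$, and $C_2^p$ spans directions from $150^\circ$ to $270^\circ$. General position: no two distinct points of $P$ lie on a line parallel to the boundary of a cone or perpendicular to the angular bisector of a cone; moreover, for every $p\in P$ and $i\in\{0,1,2\}$, if $C_i^p$ contains a point of $P\setminus\{p\}$, then exactly one point of $P\setminus\{p\}$ in $C_i^p$ minimizes the Euclidean distance to $p$. This point is called the closest point to $p$ in $C_i^p$. $\mathrm{Y}_3$-graph (Yao graph with three cones): the undirected graph with vertex set $P$ in which, for each $p\in P$ and each $i\in\{0,1,2\}$ such that $C_i^p$ contains a point of $P\setminus\{p\}$, there is an edge between $p$ and the closest point (in Euclidean distance) to $p$ in $C_i^p$. *)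

(* Defs.v *)
From HB Require Import structures.
From mathcomp Require Import all_boot all_order all_algebra.
From mathcomp Require Import finmap.
From mathcomp Require Import boolp reals trigo.
Set Implicit Arguments.
Unset Strict Implicit.
Unset Printing Implicit Defensive.
Import Order.TTheory GRing.Theory Num.Theory.
Local Open Scope ring_scope.

Section Yao3.
Variable R : realType.
Local Notation point := (R * R)%type.
Implicit Types (P : {fset R * R}) (p q r : point) (i : 'I_3).

Definition dotp p q : R := p.1 * q.1 + p.2 * q.2.

(* The norm that the library puts on R * R is the maximum norm. *)
Definition edist p q : R := Num.sqrt ((q.1 - p.1) ^+ 2 + (q.2 - p.2) ^+ 2).

Definition polar (t a : R) : point := (t * cos a, t * sin a).

(* Angles are measured counterclockwise from the positive x-axis, cones are
   numbered clockwise: C_0 spans [30, 150] degrees, C_1 spans [-90, 30] and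
   C_2 spans [-210, -90], that is, [150, 270]. *)
Definition cone_lo i : R := pi / 6 - i%:R * (2 * pi / 3).
Definition cone_hi i : R := cone_lo i + 2 * pi / 3.
Definition cone_bisector i : R := (cone_lo i + cone_hi i) / 2.

(* Both boundary rays are included; by [gp_lines] below, this is immaterial for
   points in general position. *)
Definition in_cone i p q : Prop :=
  exists t a : R, [/\ 0 <= t, cone_lo i <= a <= cone_hi i & q = p + polar t a].

Definition closest P i p q : Prop :=
  [/\ q \in (P `\ p)%fset, in_cone i p q &
      forall r, r \in (P `\ p)%fset -> in_cone i p r -> edist p q <= edist p r].

Definition on_line_along p q (a : R) : Prop := exists t : R, q - p = polar t a.

Definition gp_lines P : Prop :=
  forall p q i, p \in P -> q \in P -> p != q ->
    [/\ ~ on_line_along p q (cone_lo i),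
        ~ on_line_along p q (cone_hi i) &
        dotp (q - p) (polar 1 (cone_bisector i)) != 0].

Definition gp_closest P : Prop :=
  forall p i, p \in P -> (exists2 q, q \in (P `\ p)%fset & in_cone i p q) ->
    exists! q, closest P i p q.

Definition general_position P : Prop := gp_lines P /\ gp_closest P.

Definition Y3_edge P : rel P :=
  fun u v => `[< exists i, closest P i (val u) (val v) \/
                           closest P i (val v) (val u) >].

End Yao3.

Definition connected_graph (V : finType) (e : rel V) : Prop :=
  forall u v : V, connect e u v.

(* Main.v *)
Require Import Defs.
From HB Require Import structures.
From mathcomp Require Import all_boot all_order all_algebra.
From mathcomp Require Import finmap.
From mathcomp Require Import boolp reals trigo.
From mathcomp Require Import ring lra.
Set Implicit Arguments.
Unset Strict Implicit.
Unset Printing Implicit Defensive.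
Import Order.TTheory GRing.Theory Num.Theory.
Local Open Scope ring_scope.

(* Let a_i(z) be the component of z in the direction bisecting the lower half
   of cone i. The three a_i sum to zero, C_i is {a_i >= 0, a_(i+1) <= 0}, and
   max |a_i| is the norm whose unit ball is a regular hexagon. Among the pairs
   of points in different components choose one, (u, v), that is closest in
   this norm; after a swap, a_i(v - u) = m is the distance. Then v is in C_i^u
   and u in C_(i-1)^v, so u and v have closest points u' and v' in these cones,
   with |uu'|, |vv'| < |uv|. Because u' and v are at hexagonal distance at
   least m, u' lies beyond one particular side of the hexagon around v;
   likewise v' and u. These two facts force u' and v' to be at hexagonal
   distance less than m, although they are in different components. *)

(** * Linear forms attached to the cones *)

Section Hexagon.
Variable R : realType.
Implicit Types (z p q : R * R) (i : 'I_3) (a b m x y : R).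

Definition normal_angle i : R := cone_lo R i + pi / 6.

Definition hexform i z : R := dotp z (polar 1 (normal_angle i)).

Definition hexnorm z : R := \big[Num.max/0]_(i < 3) `|hexform i z|.

Lemma hexformB i p q : hexform i (p - q) = hexform i p - hexform i q.
Proof. by rewrite /hexform /dotp /=; ring. Qed.

Lemma hexformN i z : hexform i (- z) = - hexform i z.
Proof. by rewrite /hexform /dotp /=; ring. Qed.

Lemma cos_pi3 : cos (pi / 3) = 1 / 2 :> R.
Proof.
have c2 : cos (pi / 3 *+ 2) = - cos (pi / 3) :> R.
  have -> : pi / 3 *+ 2 = pi - pi / 3 :> R by field.
  by rewrite cosB cospi sinpi; ring.
have c0 : 0 < cos (pi / 3) :> R.
  by apply: cos_gt0_pihalf; have := pi_gt0 R; lra.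
move: c2; rewrite cos_mulr2n; set c := cos _ in c0 * => c2.
have /eqP : (c + 1) * (2 * c - 1) = 0 by move: c2; rewrite mulr2n; lra.
by rewrite mulf_eq0 => /orP[] /eqP; lra.
Qed.

Lemma cos_2pi3 : cos (2 * pi / 3) = - (1 / 2) :> R.
Proof.
have -> : 2 * pi / 3 = pi - pi / 3 :> R by field.
by rewrite cosB cospi sinpi cos_pi3; ring.
Qed.

(** Only the square of this sine enters the identities below, so the square root of 3 never
    appears. *)
Lemma sin_2pi3_sqr : sin (2 * pi / 3) ^+ 2 = 3 / 4 :> R.
Proof. by rewrite sin2cos2 cos_2pi3; field. Qed.

(** Indices in ['I_3] wrap around: from cone 2 to cone 0 the angles differ by a full turn, so only
    their cosines and sines can be compared. *)
Lemma normal_angle_succ i :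
  cos (normal_angle (i + 1)) = cos (normal_angle i - 2 * pi / 3) /\
  sin (normal_angle (i + 1)) = sin (normal_angle i - 2 * pi / 3).
Proof.
have [->|->] : normal_angle (i + 1) = normal_angle i - 2 * pi / 3 \/
    normal_angle (i + 1) = normal_angle i - 2 * pi / 3 + pi *+ 2.
- rewrite /normal_angle /cone_lo; case: i => [[|[|[|//]]]] ilt.
  + by left; rewrite (_ : nat_of_ord (_ + 1) = 1%N) //=; field.
  + by left; rewrite (_ : nat_of_ord (_ + 1) = 2%N) //=; field.
  + by right; rewrite (_ : nat_of_ord (_ + 1) = 0%N) //=; field.
- by [].
- by rewrite cosD2pi sinD2pi.
Qed.

Lemma hexformE i z :
  hexform i z = z.1 * cos (normal_angle i) + z.2 * sin (normal_angle i).
Proof. by rewrite /hexform /dotp /polar /= !mul1r. Qed.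

Lemma hexform_succ i z : hexform (i + 1) z =
  z.1 * cos (normal_angle i - 2 * pi / 3)
  + z.2 * sin (normal_angle i - 2 * pi / 3).
Proof. by have [<- <-] := normal_angle_succ i; rewrite hexformE. Qed.

Lemma hexform_sum i z :
  hexform (i + 1 + 1) z = - hexform i z - hexform (i + 1) z.
Proof.
rewrite (hexform_succ (i + 1)) hexformE (hexform_succ i).
set w := 2 * pi / 3; rewrite !(cosB _ w) !(sinB _ w).
have [-> ->] := normal_angle_succ i; rewrite !(cosB _ w) !(sinB _ w) cos_2pi3.
have := sin_2pi3_sqr; rewrite -/w.
set s := sin w; set c := cos _; set t := sin _ => s2.
have -> : z.1 * ((c * - (1 / 2) + t * s) * - (1 / 2) +
    (t * - (1 / 2) - c * s) * s) + z.2 * ((t * - (1 / 2) - c * s) * - (1 / 2)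
    - (c * - (1 / 2) + t * s) * s) = z.1 * (c / 4 - t * s - c * s ^+ 2)
    + z.2 * (t / 4 + c * s - t * s ^+ 2) by field.
by rewrite s2; field.
Qed.

Lemma sqr_norm_hexform i z : z.1 ^+ 2 + z.2 ^+ 2 =
  4 / 3 * (hexform i z ^+ 2 + hexform i z * hexform (i + 1) z
           + hexform (i + 1) z ^+ 2).
Proof.
rewrite hexform_succ hexformE; set n := normal_angle i.
rewrite cosB sinB cos_2pi3.
have := sin_2pi3_sqr; have := cos2Dsin2 n.
set s := sin (2 * pi / 3); set c := cos n; set t := sin n => ct s2.
(* In the orthonormal frame at angle [n] let z have components a and -p. The next form is - a / 2 +
   s p, so the mixed terms cancel and 3/4 a^2 + s^2 p^2 remains. *)
have -> : 4 / 3 * ((z.1 * c + z.2 * t) ^+ 2 +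
    (z.1 * c + z.2 * t) * (z.1 * (c * - (1 / 2) + t * s) +
      z.2 * (t * - (1 / 2) - c * s)) +
    (z.1 * (c * - (1 / 2) + t * s) + z.2 * (t * - (1 / 2) - c * s)) ^+ 2) =
    4 / 3 * (3 / 4 * (z.1 * c + z.2 * t) ^+ 2
      + s ^+ 2 * (z.1 * t - z.2 * c) ^+ 2) by field.
rewrite s2; transitivity ((z.1 ^+ 2 + z.2 ^+ 2) * (c ^+ 2 + t ^+ 2)).
  by rewrite ct mulr1.
by field.
Qed.

(** * Polar coordinates and cone membership *)

Lemma polar_exists z b : exists t d,
  [/\ 0 <= t, - pi <= d <= pi & z = polar t (b + d)].
Proof.
(* These are the coordinates of z in the frame rotated by [b]; the angle [d] is the arccosine of
   [X / t], with the sign of [Y]. *)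
pose X := z.1 * cos b + z.2 * sin b; pose Y := - z.1 * sin b + z.2 * cos b.
have zE t c s : t * c = X -> t * s = Y ->
    z = (t * (cos b * c - sin b * s), t * (sin b * c + cos b * s)).
  move=> tc ts; rewrite [LHS]surjective_pairing.
  have -> : t * (cos b * c - sin b * s) = cos b * (t * c) - sin b * (t * s).
    by ring.
  have -> : t * (sin b * c + cos b * s) = sin b * (t * c) + cos b * (t * s).
    by ring.
  rewrite tc ts /X /Y; congr (_, _).
  - by rewrite -[LHS]mulr1 -(cos2Dsin2 b); ring.
  - by rewrite -[LHS]mulr1 -(cos2Dsin2 b); ring.
pose t := Num.sqrt (X ^+ 2 + Y ^+ 2).
have t2 : t ^+ 2 = X ^+ 2 + Y ^+ 2 by rewrite sqr_sqrtr //; nra.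
have t0 : 0 <= t by exact: sqrtr_ge0.
have [t_eq0|tN0] := eqVneq t 0.
  exists 0, 0; split; first by [].
    by have := pi_ge0 R; lra.
  rewrite /polar !mul0r.
  have X0 : X = 0 by move: t2; rewrite t_eq0; nra.
  have Y0 : Y = 0 by move: t2; rewrite t_eq0; nra.
  by rewrite (zE 0 0 0) ?mul0r.
have t_gt0 : 0 < t by rewrite lt_def tN0.
have Xt1 : -1 <= X / t <= 1.
  by rewrite ler_pdivlMr// ler_pdivrMr//; nra.
have cosE : t * cos (acos (X / t)) = X.
  by rewrite acosK // mulrC divfK.
have sinE : t * sin (acos (X / t)) = `|Y|.
  rewrite sin_acos // -{1}(ger0_norm t0) -sqrtr_sqr -sqrtrM ?sqr_ge0 //.
  rewrite -sqrtr_sqr; congr Num.sqrt.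
  by rewrite mulrBr mulr1 -exprMn [t * _]mulrC divfK // t2; ring.
have [acos0 acospi] := (acos_ge0 Xt1, acos_lepi Xt1).
have [Y0|Y0] := leP 0 Y.
  exists t, (acos (X / t)); split=> //; first lra.
  by rewrite /polar cosD sinD; apply: zE => //; rewrite sinE ger0_norm.
exists t, (- acos (X / t)); split=> //; first lra.
rewrite /polar cosD sinD cosN sinN; apply: zE => //.
by rewrite mulrN sinE ltr0_norm // opprK.
Qed.

Lemma hexform_polar i t a :
  hexform i (polar t a) = t * cos (a - normal_angle i).
Proof. by rewrite hexformE cosB /=; ring. Qed.

Lemma hexform_succ_polar i t a :
  hexform (i + 1) (polar t a) = - (t * cos (a - normal_angle i - pi / 3)).
Proof.
rewrite hexform_polar cosB.
have [-> ->] := normal_angle_succ i.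
have -> : normal_angle i - 2 * pi / 3 = normal_angle i + pi / 3 - pi.
  by field.
have -> : a - normal_angle i - pi / 3 = a - (normal_angle i + pi / 3) by ring.
rewrite (cosB a) (cosB _ pi) (sinB _ pi) cospi sinpi; ring.
Qed.

Lemma in_coneP i p q :
  in_cone i p q <-> 0 <= hexform i (q - p) /\ hexform (i + 1) (q - p) <= 0.
Proof.
have pi0 := pi_gt0 R.
split=> [[t [a [t0 /andP[lo hi] ->]]]|[]].
  rewrite addrC addKr hexform_polar hexform_succ_polar oppr_le0.
  by split; apply: mulr_ge0 => //; apply: cos_ge0_pihalf;
    move: lo hi; rewrite /normal_angle /cone_hi; lra.
(* The reference angle is the bisector of the cone, so membership means that [d] lies between - pi /
   3 and pi / 3. *)
have [t [d [t0 /andP[dge dle] qp]]] :=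
  polar_exists (q - p) (normal_angle i + pi / 6).
rewrite qp hexform_polar hexform_succ_polar oppr_le0.
have -> : normal_angle i + pi / 6 + d - normal_angle i = d + pi / 6 by ring.
have -> : d + pi / 6 - pi / 3 = d - pi / 6 by field.
have qE : q = p + polar t (normal_angle i + pi / 6 + d) by rewrite -qp addrC subrK.
(* At the apex the forms say nothing about [d], and any angle of the cone serves. *)
have [t_eq0 _ _|tN0] := eqVneq t 0.
  exists 0, (cone_lo R i); split=> //; first by rewrite /cone_hi; lra.
  by rewrite qE t_eq0 /polar !mul0r.
have t_gt0 : 0 < t by rewrite lt_def tN0.
rewrite !pmulr_rge0 // => h1 h2.
(* Past this bound a shift by pi brings [d + pi / 6] to where cosine is positive, so the first form
   would be negative; the lower bound follows likewise from the second form. *)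
have d_le : d <= pi / 3.
  rewrite leNgt; apply/negP => dgt.
  suff : 0 < cos (d + pi / 6 - pi) by rewrite cosB cospi sinpi; lra.
  by apply: cos_gt0_pihalf; lra.
have d_ge : - (pi / 3) <= d.
  rewrite leNgt; apply/negP => dlt.
  suff : 0 < cos (d - pi / 6 + pi) by rewrite cosD cospi sinpi; lra.
  by apply: cos_gt0_pihalf; lra.
exists t, (normal_angle i + pi / 6 + d); split=> //.
by rewrite /normal_angle /cone_hi; lra.
Qed.

Lemma edist_lt_hexform i p q r : edist p q < edist p r ->
  hexform i (q - p) ^+ 2 + hexform i (q - p) * hexform (i + 1) (q - p)
    + hexform (i + 1) (q - p) ^+ 2 <
  hexform i (r - p) ^+ 2 + hexform i (r - p) * hexform (i + 1) (r - p)
    + hexform (i + 1) (r - p) ^+ 2.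
Proof.
apply: contraTT; rewrite -!leNgt => le_rq; apply: ler_wsqrtr.
rewrite (sqr_norm_hexform i (r - p)) (sqr_norm_hexform i (q - p)).
by rewrite ler_pM2l //; lra.
Qed.

Lemma hexform_eq0_on_line i p q :
  hexform i (q - p) = 0 -> on_line_along p q (cone_hi R i).
Proof.
rewrite hexformE /on_line_along /polar.
have -> : cone_hi R i = normal_angle i + pi / 2.
  by rewrite /normal_angle /cone_hi; field.
set z := q - p; set n := normal_angle i => h0.
exists (- z.1 * sin n + z.2 * cos n).
rewrite cosDpihalf sinDpihalf [LHS]surjective_pairing; congr (_, _).
- rewrite -[LHS]mulr1 -(cos2Dsin2 n) -[RHS]addr0 -(mul0r (cos n)) -h0; ring.
- rewrite -[LHS]mulr1 -(cos2Dsin2 n) -[RHS]addr0 -(mul0r (sin n)) -h0; ring.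
Qed.

(** * The hexagonal norm *)

Lemma hexnorm_attained z : exists i, hexnorm z = `|hexform i z|.
Proof.
pose F i := `|hexform i z|; exists [arg max_(i > ord0) F i]%O.
case: arg_maxP => // i _ Fi; apply/le_anti/andP; split.
- by apply: bigmax_le => // j _; exact: Fi.
- exact: (le_bigmax _ F i).
Qed.

Lemma hexform_le_norm i z : `|hexform i z| <= hexnorm z.
Proof. exact: (le_bigmax _ (fun j => `|hexform j z|) i). Qed.

Lemma hexnorm_geP m z i : m <= hexnorm z ->
  [\/ m <= `|hexform i z|, m <= `|hexform (i + 1) z|
    | m <= `|hexform (i + 1 + 1) z|].
Proof.
have [j ->] := hexnorm_attained z.
have : [\/ j = i, j = i + 1 | j = i + 1 + 1].
  case: i j => [[|[|[|//]]] ilt] [[|[|[|//]]] jlt];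
    by [apply: Or31; apply: val_inj | apply: Or32; apply: val_inj
       | apply: Or33; apply: val_inj].
by case=> ->; [exact: Or31 | exact: Or32 | exact: Or33].
Qed.

Lemma hexnormN z : hexnorm (- z) = hexnorm z.
Proof. by apply: eq_bigr => i _; rewrite hexformN normrN. Qed.

End Hexagon.

(** * Inequalities for the two neighbours *)

(* In the coordinates a_i, a_(i+1), a_(i+2) relative to u, v = (m, -k, k - m)
   and u' = (x, -y, y - x). *)
Lemma hexagon_side (R : realFieldType) (m k x y : R) :
  0 <= k <= m -> 0 < x -> 0 < y ->
  x ^+ 2 - x * y + y ^+ 2 < m ^+ 2 - m * k + k ^+ 2 ->
  [\/ m <= `|m - x|, m <= `|- k + y| | m <= `|k - m + x - y|] ->
  x + k <= y.
Proof.
move=> /andP[k0 km] x0 y0 Q.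
have mk : m ^+ 2 - m * k + k ^+ 2 <= m ^+ 2 by nra.
(* Of the six sides, m <= - (k - m + x - y) is the claim, and m <= y - k implies it by the bound
   m^2; the other four are contradictory. *)
by case; rewrite ler_normr => /orP[] h; nra.
Qed.

(* Here v' = v + (- s, s - t, t). *)
Lemma hexagon_exchange (R : realFieldType) (m k x y s t : R) :
  0 <= k <= m -> 0 < x -> 0 < y -> 0 < s -> 0 < t ->
  x ^+ 2 - x * y + y ^+ 2 < m ^+ 2 - m * k + k ^+ 2 ->
  s ^+ 2 - s * t + t ^+ 2 < m ^+ 2 - m * k + k ^+ 2 ->
  [\/ m <= `|m - x|, m <= `|- k + y| | m <= `|k - m + x - y|] ->
  [\/ m <= `|m - s|, m <= `|- k + s - t| | m <= `|k - m + t|] ->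
  [\/ m <= `|m - s - x|, m <= `|- k + s - t + y|
    | m <= `|k - m + t + x - y|] -> False.
Proof.
move=> kle x0 y0 s0 t0 Qx Qs Hx Hs.
have xy := hexagon_side kle x0 y0 Qx Hx.
(* The reflection taking (a_i, a_(i+1), a_(i+2)) to (- a_i, - a_(i+2), - a_(i+1)) exchanges the
   roles of u and v and replaces (k, x, y) by (m - k, s, t). *)
have st : s + (m - k) <= t.
  have Hs' : [\/ m <= `|m - s|, m <= `|- (m - k) + t|
                | m <= `|(m - k) - m + s - t|].
    case: Hs => h; [exact: Or31 | apply: Or33 | apply: Or32];
      by apply: le_trans h _; rewrite le_eqVlt; apply/orP; left; apply/eqP;
         congr `|_|; ring.
  by apply: hexagon_side Hs' => //; [case/andP: kle; lra | nra].
move: kle => /andP[k0 km].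
have mk : m ^+ 2 - m * k + k ^+ 2 <= m ^+ 2 by nra.
have m0 : 0 <= m by lra.
have xy_gt0 := mulr_gt0 x0 y0; have st_gt0 := mulr_gt0 s0 t0.
(* The aim is k <= y - x < m, m - k <= t - s < m and x, s < m; these linear bounds rule out all six
   sides. *)
have sqr_lt a : a ^+ 2 < m ^+ 2 -> a < m.
  by move=> am; rewrite ltNge; apply/negP; nra.
have yxm : y - x < m by apply: sqr_lt; rewrite sqrrB mulr2n; lra.
have tsm : t - s < m by apply: sqr_lt; rewrite sqrrB mulr2n; lra.
have xm : x < m by apply: sqr_lt; nra.
have sm : s < m by apply: sqr_lt; nra.
by case; rewrite ler_normr => /orP[]; lra.
Qed.

(** * Neighbours in the Yao graph *)

Section Connectivity.
Variables (R : realType) (P : {fset R * R}).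
Hypothesis P_gp : general_position P.
Local Notation e := (@Y3_edge R P).

Lemma Y3_edge_sym : symmetric e.
Proof. by move=> u v; apply: asbool_equiv_eq; split=> -[i []]; exists i; auto. Qed.

(** The form vanishes only along the upper boundary direction of cone i, which general position
    excludes. This makes the cone inequalities strict. *)
Lemma hexform_neq0 i (u v : P) : u != v -> hexform i (val v - val u) != 0.
Proof.
move=> uv; apply/eqP => /hexform_eq0_on_line.
by case: P_gp => /(_ (val u) (val v) i (valP u) (valP v) uv) [].
Qed.

(** The inequality is strict because a tie would make v a closest point too; by uniqueness v would
    then be a neighbour of u. *)
Lemma closer_neighbor i (u v : P) :
  ~~ connect e u v -> in_cone i (val u) (val v) ->
  exists u', [/\ connect e u u', u != u', in_cone i (val u) (val u')
    & edist (val u) (val u') < edist (val u) (val v)].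
Proof.
move=> uv uCv; have vP : val v \in (P `\ val u)%fset.
  rewrite !inE (valP v) andbT; apply: contraNneq uv => /val_inj ->.
  exact: connect0.
have [w [wP Cw w_min] w_uniq] : exists2 w, closest P i (val u) w
    & forall w', closest P i (val u) w' -> w = w'.
  have [|w []] := P_gp.2 (val u) i (valP u); first by exists (val v).
  by exists w.
have /[!inE] /andP[wu wP'] := wP.
pose u' : P := FSetSub wP'.
have uu' : connect e u u' by apply/connect1/asboolP; exists i; left; split.
exists u'; split => //; first by rewrite eq_sym -val_eqE.
rewrite lt_neqAle w_min // andbT; apply: contra uv => /eqP wv.
suff -> : v = u' by [].
apply/val_inj/esym/w_uniq; split=> // r rP rC.
by rewrite -wv; exact: w_min.
Qed.

End Connectivity.

Theorem theorem10 (R : realType) (P : {fset R * R}) (P_neq0 : P != fset0%fset)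
    (P_gp : general_position P) :
  connected_graph (@Y3_edge R P).
Proof.
move=> u0 v0; apply: contraT => uv0; set e := @Y3_edge R P in uv0.
have e_sym : connect_sym e := sym_connect_sym (@Y3_edge_sym R P).
have [i [u [v [uv mE m_min]]]] : exists i (u v : P), [/\ ~~ connect e u v,
    hexform i (val v - val u) = hexnorm (val v - val u) &
    forall u' v' : P, ~~ connect e u' v' ->
      hexnorm (val v - val u) <= hexnorm (val v' - val u')].
  pose D := [pred w : P * P | ~~ connect e w.1 w.2].
  pose N (w : P * P) := hexnorm (val w.2 - val w.1).
  have D0 : D (u0, v0) by [].
  case: (arg_minP N D0) => -[u v] /= uv N_min.
  have [i hi] := hexnorm_attained (val v - val u).
  have [h0|h0] := leP 0 (hexform i (val v - val u)).
    rewrite ger0_norm // in hi.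
    by exists i, u, v; split=> // u' v' /(N_min (u', v')).
  exists i, v, u; rewrite -[val u - val v]opprB hexnormN; split.
  - by rewrite e_sym.
  - by rewrite hexformN hi ltr0_norm.
  - by move=> u' v' /(N_min (u', v')).
set m := hexnorm _ in mE m_min.
have i3 : i + 1 + 1 + 1 = i by apply: val_inj; case: (i) => [[|[|[|]]]].
pose A (w : P) := hexform i (val w); pose B (w : P) := hexform (i + 1) (val w).
have hA (w w' : P) : hexform i (val w' - val w) = A w' - A w.
  exact: hexformB.
have hB (w w' : P) : hexform (i + 1) (val w' - val w) = B w' - B w.
  exact: hexformB.
have hC (w w' : P) : hexform (i + 1 + 1) (val w' - val w) =
    - (A w' - A w) - (B w' - B w) by rewrite hexform_sum hA hB.
(* Points taken from the components of u and v are again disconnected, so minimality applies to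
   them. *)
have far (w w' : P) : connect e u w -> connect e v w' ->
    [\/ m <= `|A w' - A w|, m <= `|B w' - B w|
      | m <= `|- (A w' - A w) - (B w' - B w)|].
  move=> uw vw'; rewrite -hC -hA -hB; apply/hexnorm_geP/m_min.
  apply: contra uv => ww'; apply: connect_trans uw (connect_trans ww' _).
  by rewrite e_sym.
have mA : A v - A u = m by rewrite -hA.
(* The forms sum to zero and the first equals m, so the bound m on the other two forces both to be
   nonpositive. *)
have kB : 0 <= - (B v - B u) <= m.
  have := hexform_le_norm (i + 1) (val v - val u).
  have := hexform_le_norm (i + 1 + 1) (val v - val u).
  by rewrite hB hC mA -/m !ler_norml => /andP[? ?] /andP[? ?]; lra.
have [|u' [uu' uNu' /in_coneP[]]] := closer_neighbor (i := i) P_gp uv.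
  by apply/in_coneP; rewrite hA hB; lra.
rewrite hA hB => x0 y0 /(edist_lt_hexform i); rewrite /= !hA !hB mA => Qx.
have vu : ~~ connect e v u by rewrite e_sym.
have [|v' [vv' vNv' /in_coneP[]]] := closer_neighbor (i := i + 1 + 1) P_gp vu.
  by apply/in_coneP; rewrite i3 hA hC; lra.
rewrite i3 hA hC => t0 s0 /(edist_lt_hexform (i + 1 + 1)).
rewrite /= i3 !hA !hC => Qs.
have := hexform_neq0 P_gp i uNu'; have := hexform_neq0 P_gp (i + 1) uNu'.
have := hexform_neq0 P_gp i vNv'; have := hexform_neq0 P_gp (i + 1 + 1) vNv'.
rewrite !hA hB hC => tN0 sN0 yN0 xN0.
have conv (a b c a' b' c' : R) :
    [\/ m <= `|a|, m <= `|b| | m <= `|c|] -> a = a' -> b = b' -> c = c' ->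
    [\/ m <= `|a'|, m <= `|b'| | m <= `|c'|] by move=> + <- <- <-.
have uu := connect0 e u; have vv := connect0 e v.
(* The last argument is the component a_(i+2) of v' - v, written through the other two. *)
case: (@hexagon_exchange R m (- (B v - B u)) (A u' - A u) (- (B u' - B u))
  (- (A v' - A v)) (- (A v' - A v) - (B v' - B v))) => //.
- by rewrite lt_def xN0.
- by rewrite lt_def oppr_eq0 yN0 oppr_ge0.
- by rewrite lt_def oppr_eq0 sN0 oppr_ge0.
- by rewrite lt_def tN0.
- by move: Qx; set b := B v - B u; lra.
- by move: Qs; have -> : A u = A v - m; lra.
- by apply: conv (far _ _ uu' vv) _ _ _; lra.
- by apply: conv (far _ _ uu vv') _ _ _; lra.
- by apply: conv (far _ _ uu' vv') _ _ _; lra.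
Qed.
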